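(* Let $A_0 \in \{-1,0,1\}^{m_0\times n_0}$ be an EQ matrix. For integers $k\ge 1$ define recursively \[ A_k = \begin{bmatrix} A_{k-1} & A_{k-1} & I_{m_{k-1}} \\ A_{k-1} & -A_{k-1} & 0 \end{bmatrix}, \] where $A_{k-1}$ has size $m_{k-1}\times n_{k-1}$, $I_{m_{k-1}}$ is the $m_{k-1}\times m_{k-1}$ identity matrix and $0$ is the $m_{k-1}\times m_{k-1}$ zero matrix. Then for every integer $k\ge 0$, $A_k$ is an EQ matrix (with entries in $\{-1,0,1\}$) of size $m_k\times n_k$, where $m_k = 2^k m_0$ and $n_k = 2^k n_0\left(\frac{k}{2}\frac{m_0}{n_0}+1\right)$.
   Context: A matrix $A\in\mathbb{Z}^{m\times n}$ is called an EQ matrix if the homogeneous system $Ax=0$ has no non-trivial solution $x\in\{-1,0,1\}^n$ (i.e., the only solution in $\{-1,0,1\}^n$ is $x=0$). *)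

(* Defs.v *)
From mathcomp Require Import all_boot all_order all_algebra.

Set Implicit Arguments.
Unset Strict Implicit.
Unset Printing Implicit Defensive.

Import GRing.Theory.
Local Open Scope ring_scope.

Definition sign_entries (m n : nat) (A : 'M[int]_(m, n)) : Prop :=
  forall i j, A i j \in [:: -1; 0; 1].

Definition EQ_matrix (m n : nat) (A : 'M[int]_(m, n)) : Prop :=
  forall x : 'cV[int]_n, sign_entries x -> A *m x = 0 -> x = 0.

(* The dimensions are computed by the recursion that the block shape of [A_k]
   imposes, so that the closed forms for them are statements to be proved. *)
Fixpoint EQ_rows (m0 k : nat) : nat :=
  if k is k'.+1 then (EQ_rows m0 k' + EQ_rows m0 k')%N else m0.

Fixpoint EQ_cols (m0 n0 k : nat) : nat :=
  if k is k'.+1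
  then (EQ_cols m0 n0 k' + EQ_cols m0 n0 k' + EQ_rows m0 k')%N
  else n0.

Fixpoint EQ_seq (m0 n0 : nat) (A0 : 'M[int]_(m0, n0)) (k : nat) :
    'M[int]_(EQ_rows m0 k, EQ_cols m0 n0 k) :=
  match k with
  | 0 => A0
  | k'.+1 =>
      let A := EQ_seq A0 k' in
      block_mx (row_mx A   A ) 1%:M
               (row_mx A (- A)) 0
  end.

(* Main.v *)
Require Import Defs.
From mathcomp Require Import all_boot all_order all_algebra.
From mathcomp Require Import zify ring.

Set Implicit Arguments.
Unset Strict Implicit.
Unset Printing Implicit Defensive.

Import GRing.Theory.
Local Open Scope ring_scope.

(** A solution [(u, v, w)] of the doubled system satisfies [A u = A v] and
    [A u + A v + w = 0], so [w = - 2 A u] has even entries.  Entries of [w] lie in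
    [{-1, 0, 1}], hence [w = 0] and [A u = A v = 0]. *)

Definition EQ_step (m n : nat) (A : 'M[int]_(m, n)) : 'M[int]_(m + m, n + n + m) :=
  block_mx (row_mx A A) 1%:M (row_mx A (- A)) 0.

Lemma EQ_step_EQ_matrix (m n : nat) (A : 'M[int]_(m, n)) :
  EQ_matrix A -> EQ_matrix (EQ_step A).
Proof.
move=> hA x; rewrite -[x]vsubmxK -[usubmx x]vsubmxK.
move: (usubmx (usubmx x)) (dsubmx (usubmx x)) (dsubmx x) => u v w hx.
have hu : sign_entries u.
  by move=> i j; have := hx (lshift m (lshift n i)) j; rewrite !col_mxEu.
have hv : sign_entries v.
  by move=> i j; have := hx (lshift m (rshift n i)) j; rewrite col_mxEu col_mxEd.
have hw : sign_entries w.
  by move=> i j; have := hx (rshift (n + n) i) j; rewrite col_mxEd.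
rewrite /EQ_step mul_block_col !mul_row_col mul1mx mul0mx addr0 mulNmx.
(* The zero column is cut into two blocks so that the equation splits: the top block is [sum0], the
   bottom one gives [A *m u = A *m v]. *)
rewrite -[RHS]vsubmxK !linear0 => /eq_col_mx[sum0 /subr0_eq Auv].
have w0 : w = 0.
  apply/matrixP => i j; have := hw i j.
  move/matrixP/(_ i j): sum0; rewrite -Auv !mxE !inE.
  (* Since [A *m v] was replaced by [A *m u], both sums are the same integer [a], and
     [a + a + b = 0] with [b] in [{-1, 0, 1}] forces [b = 0] by parity. *)
  by move: (\sum_k _) (w i j) => a b; lia.
have Au0 : A *m u = 0.
  apply/matrixP => i j; move/matrixP/(_ i j): sum0.
  rewrite -Auv w0 !mxE; move: (\sum_k _) => a; lia.
by rewrite w0 (hA u) // (hA v) -?Auv // !col_mx0.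
Qed.

Lemma EQ_step_sign_entries (m n : nat) (A : 'M[int]_(m, n)) :
  sign_entries A -> sign_entries (EQ_step A).
Proof.
move=> hA i j; rewrite /EQ_step.
case: (split_ordP i) => {}i ->; case: (split_ordP j) => {}j ->.
- by rewrite block_mxEul; case: (split_ordP j) => {}j ->;
    rewrite ?row_mxEl ?row_mxEr.
- by rewrite block_mxEur !mxE; case: eqP.
- rewrite block_mxEdl; case: (split_ordP j) => {}j ->;
    rewrite ?row_mxEl ?row_mxEr // mxE.
  (* The block [- A] is harmless because [{-1, 0, 1}] is closed under negation. *)
  by have := hA i j; rewrite !inE => /or3P[] /eqP ->.
- by rewrite block_mxEdr mxE.
Qed.

Lemma EQ_rowsE (m0 k : nat) : EQ_rows m0 k = (2 ^ k * m0)%N.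
Proof. by elim: k => [|k IHk] /=; rewrite ?mul1n // IHk expnS; lia. Qed.

(** The factor 2 clears the [k / 2] of the closed form, so the induction stays in [nat] without
    division or a truncated exponent [k - 1]. *)
Lemma EQ_colsE (m0 n0 k : nat) :
  (2 * EQ_cols m0 n0 k = 2 ^ k * (2 * n0 + k * m0))%N.
Proof.
elim: k => [|k IHk]; first by rewrite expn0 mul1n addn0.
rewrite [EQ_cols _ _ _]/= [LHS]mulnDr [X in (X + _)%N]mulnDr IHk EQ_rowsE expnS.
by ring.
Qed.

Theorem theorem1 (m0 n0 : nat) (A0 : 'M[int]_(m0, n0))
    (hn0 : (0 < n0)%N) (hA0 : sign_entries A0) (hEQ : EQ_matrix A0) (k : nat) :
  [/\ EQ_matrix (EQ_seq A0 k),
      sign_entries (EQ_seq A0 k),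
      EQ_rows m0 k = (2 ^ k * m0)%N
    & (EQ_cols m0 n0 k)%:R =
        2%:R ^+ k * n0%:R * (k%:R / 2%:R * (m0%:R / n0%:R) + 1) :> rat].
Proof.
split; last 1 first.
- have n0_neq0 : n0%:R != 0 :> rat by rewrite Num.Theory.pnatr_eq0 -lt0n.
  have two_neq0 : 2%:R != 0 :> rat by [].
  (* Doubling both sides in [rat] makes [EQ_colsE] applicable; [n0_neq0] lets [field] cancel the
     denominator of [m0 / n0]. *)
  apply: (mulfI two_neq0); rewrite -natrM EQ_colsE !(natrM, natrD, natrX).
  by field.
- by elim: k => //= k; apply: EQ_step_EQ_matrix.
- by elim: k => //= k; apply: EQ_step_sign_entries.
- exact: EQ_rowsE.
Qed.
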